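(* For any fixed $i,j\in\{0,1,2\}$, one has $\displaystyle\sum_{k=0}^{2}\sum_{\ell=0}^{2}W_{y/x}(i,j;k,\ell)=1$.
   Context: For $i,j,k,\ell\in\{0,1,2\}$ the Izergin--Korepin vertex weight $W_{y/x}(i,j;k,\ell)$ is a rational function of $q$ and $y/x$ which, with $D=(x-q^2y)(x-q^3y)$, is given by $W(0,0;0,0)=W(2,2;2,2)=1$; $W(1,0;1,0)=W(2,1;2,1)=\frac{q^2(x-y)}{x-q^2y}$; $W(1,0;0,1)=W(2,1;1,2)=\frac{(1-q^2)x}{x-q^2y}$; $W(0,1;1,0)=W(1,2;2,1)=\frac{(1-q^2)y}{x-q^2y}$; $W(0,1;0,1)=W(1,2;1,2)=\frac{x-y}{x-q^2y}$; $W(2,0;2,0)=\frac{q^4(x-y)(x-qy)}{D}$; $W(2,0;1,1)=-\frac{q(1-q)^2(1+q)x(x-y)}{D}$; $W(2,0;0,2)=\frac{(1-q^2)x(x+qx-qy-q^3y)}{D}$; $W(1,1;2,0)=-\frac{q^4(1+q)(x-y)y}{D}$; $W(1,1;1,1)=\frac{-qx^2+(1+q)(1-q^2+q^4)xy-q^4y^2}{D}$; $W(1,1;0,2)=\frac{(1+q)x(x-y)}{D}$; $W(0,2;2,0)=\frac{(1-q^2)(x+q^2x-q^2y-q^3y)y}{D}$; $W(0,2;1,1)=\frac{q(1-q)^2(1+q)(x-y)y}{D}$; $W(0,2;0,2)=\frac{(x-y)(x-qy)}{D}$; and $W=0$ in all other cases. *)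

(* Defs.v *)
From mathcomp Require Import all_boot all_order all_algebra.
From mathcomp Require Import ring.
Set Implicit Arguments.
Unset Strict Implicit.
Unset Printing Implicit Defensive.
Import GRing.Theory.
Local Open Scope ring_scope.

(* The Izergin-Korepin weight W_{y/x}(i,j;k,l), as a function of values of q, x
   and y in an arbitrary field.  The identities between rational functions are
   recovered by taking F to be a field of rational functions in q, x and y. *)
Definition IK_weight (F : fieldType) (q x y : F) (i j k l : 'I_3) : F :=
  let D := (x - q ^+ 2 * y) * (x - q ^+ 3 * y) in
  match (i : nat), (j : nat), (k : nat), (l : nat) with
  | 0%N, 0%N, 0%N, 0%N | 2%N, 2%N, 2%N, 2%N => 1
  | 1%N, 0%N, 1%N, 0%N | 2%N, 1%N, 2%N, 1%N =>
      q ^+ 2 * (x - y) / (x - q ^+ 2 * y)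
  | 1%N, 0%N, 0%N, 1%N | 2%N, 1%N, 1%N, 2%N =>
      (1 - q ^+ 2) * x / (x - q ^+ 2 * y)
  | 0%N, 1%N, 1%N, 0%N | 1%N, 2%N, 2%N, 1%N =>
      (1 - q ^+ 2) * y / (x - q ^+ 2 * y)
  | 0%N, 1%N, 0%N, 1%N | 1%N, 2%N, 1%N, 2%N =>
      (x - y) / (x - q ^+ 2 * y)
  | 2%N, 0%N, 2%N, 0%N =>
      q ^+ 4 * (x - y) * (x - q * y) / D
  | 2%N, 0%N, 1%N, 1%N =>
      - (q * (1 - q) ^+ 2 * (1 + q) * x * (x - y) / D)
  | 2%N, 0%N, 0%N, 2%N =>
      (1 - q ^+ 2) * x * (x + q * x - q * y - q ^+ 3 * y) / D
  | 1%N, 1%N, 2%N, 0%N =>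
      - (q ^+ 4 * (1 + q) * (x - y) * y / D)
  | 1%N, 1%N, 1%N, 1%N =>
      (- (q * x ^+ 2) + (1 + q) * (1 - q ^+ 2 + q ^+ 4) * x * y
        - q ^+ 4 * y ^+ 2) / D
  | 1%N, 1%N, 0%N, 2%N =>
      (1 + q) * x * (x - y) / D
  | 0%N, 2%N, 2%N, 0%N =>
      (1 - q ^+ 2) * (x + q ^+ 2 * x - q ^+ 2 * y - q ^+ 3 * y) * y / D
  | 0%N, 2%N, 1%N, 1%N =>
      q * (1 - q) ^+ 2 * (1 + q) * (x - y) * y / D
  | 0%N, 2%N, 0%N, 2%N =>
      (x - y) * (x - q * y) / D
  | _, _, _, _ => 0
  end.

(* The weight depends on x and y only through the spectral parameter y / x. *)
Lemma IK_weight_spectral (F : fieldType) (q x y : F) (i j k l : 'I_3) :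
    x != 0 -> x - q ^+ 2 * y != 0 -> x - q ^+ 3 * y != 0 ->
  IK_weight q x y i j k l = IK_weight q 1 (y / x) i j k l.
Proof.
move=> x0 D2 D3.
have E2 : 1 - q ^+ 2 * (y / x) = (x - q ^+ 2 * y) / x by field.
have E3 : 1 - q ^+ 3 * (y / x) = (x - q ^+ 3 * y) / x by field.
case: i => [[|[|[|i]]] Hi] //; case: j => [[|[|[|j]]] Hj] //;
  case: k => [[|[|[|k]]] Hk] //; case: l => [[|[|[|l]]] Hl] //;
  rewrite /IK_weight /= ?E2 ?E3 //; field; rewrite ?x0 ?D2 ?D3 //.
Qed.

(* Main.v *)
Require Import Defs.
From mathcomp Require Import all_boot all_order all_algebra.
From mathcomp Require Import ring.
Import GRing.Theory.
Local Open Scope ring_scope.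

(** For each of the nine pairs [(i, j)] at most three weights are nonzero, namely
    those with [k + l = i + j]. Over the common denominator, which is [1],
    [x - q ^+ 2 * y] or [(x - q ^+ 2 * y) * (x - q ^+ 3 * y)], their numerators
    add up to the denominator; this is a polynomial identity in [q], [x], [y]. *)

Theorem proposition3p1p4 (F : fieldType) (q x y : F) (i j : 'I_3)
    (h2 : x - q ^+ 2 * y != 0) (h3 : x - q ^+ 3 * y != 0) :
  \sum_(k < 3) \sum_(l < 3) IK_weight q x y i j k l = 1.
Proof.
rewrite !big_ord_recl !big_ord0.
case: i => [[|[|[|i]]] Hi] //; case: j => [[|[|[|j]]] Hj] //;
  rewrite /IK_weight /=; field; rewrite ?h2 ?h3 //.
Qed.
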